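(* For every bridgeless cubic graph $G$, $scc(G)>\frac{4}{3}\cdot|E(G)|$ if and only if $G$ is frumious; otherwise (that is, if $G$ is not frumious) $scc(G)=\frac{4}{3}\cdot|E(G)|$.
   Context: Graphs may contain parallel edges but no loops; bridgeless means $2$-edge-connected. A cycle is an even subgraph (a subgraph all of whose degrees are even). A cycle cover of $G$ is a family $\mathcal{C}$ of cycles of $G$ such that every edge of $G$ is contained in at least one cycle of $\mathcal{C}$; its length is the sum of the numbers of edges of the cycles in $\mathcal{C}$. $scc(G)$ is the minimum length of a cycle cover of $G$. A multigraph is Class I if its chromatic index equals its maximum degree. For a perfect matching $M$ of $G$ and an integer $t\ge 0$, $G+tM$ is the multigraph obtained from $G$ by adding $t$ parallel edges to every edge of $M$. $l_M(G)$ is the minimum $t\ge 0$ such that $G+tM$ is Class I, and $l_M(G)=+\infty$ if no such $t$ exists. A bridgeless cubic graph $G$ is frumious if $l_M(G)=+\infty$ for all perfect matchings $M$ of $G$. *)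

(* Defs.v *)
From HB Require Import structures.
From mathcomp Require Import all_boot all_order all_algebra.
From mathcomp Require Import boolp constructive_ereal.

Set Implicit Arguments.
Unset Strict Implicit.
Unset Printing Implicit Defensive.

Import Order.TTheory GRing.Theory Num.Theory.

(* Finite graphs with parallel edges but without loops: edges have an identity
   of their own, and distinct edges may have the same pair of ends. *)
Record mgraph := MGraph {
  vertex : finType;
  edge : finType;
  ends : edge -> {set vertex};
  card_ends : forall e, #|ends e| = 2
}.

Section Multigraph.
Variable G : mgraph.
Implicit Types (A C M F : {set edge G}) (u v : vertex G) (e : edge G).

(* Degree of v in the spanning subgraph with edge set A. *)
Definition deg_in A v : nat := #|[set e in A | v \in ends e]|.

Definition degree v : nat := deg_in [set: edge G] v.

Definition max_degree : nat := \max_(v : vertex G) degree v.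

Definition cubic : Prop := forall v, degree v = 3.

Definition adj A : rel (vertex G) :=
  fun u v => [exists e in A, ends e == [set u; v]].

(* Connectedness of the spanning subgraph with edge set A. *)
Definition connected A : Prop := forall u v, connect (adj A) u v.

Definition edge_connected (k : nat) : Prop :=
  1 < #|vertex G| /\ (forall F, #|F| < k -> connected (~: F)).

Definition bridgeless : Prop := edge_connected 2.

(* An even subgraph, given by its edge set: isolated vertices matter neither
   for covering edges nor for the length of a cover. *)
Definition is_cycle C : Prop := forall v, ~~ odd (deg_in C v).

(* Covers are families, so a cycle may be repeated. *)
Definition cycle_cover (CC : seq {set edge G}) : Prop :=
  (forall C, C \in CC -> is_cycle C) /\
  (forall e, exists2 C, C \in CC & e \in C).

Definition cover_length (CC : seq {set edge G}) : nat := \sum_(C <- CC) #|C|.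

Definition perfect_matching M : Prop := forall v, deg_in M v = 1.

Definition edge_colorable (k : nat) : bool :=
  [exists f : {ffun edge G -> 'I_k}, forall e, forall e',
     (e != e') && ~~ [disjoint ends e & ends e'] ==> (f e != f e')].

Lemma edge_colorable_ex : exists k, edge_colorable k.
Proof.
exists #|edge G|; apply/existsP; exists [ffun e => enum_rank e].
apply/forallP=> e; apply/forallP=> e'; apply/implyP=> /andP[ne _].
by rewrite !ffunE (inj_eq enum_rank_inj).
Qed.

Definition chromatic_index : nat := ex_minn edge_colorable_ex.

Definition class_I : Prop := chromatic_index = max_degree.

Section AddMatching.
Variables (M : {set edge G}) (t : nat).

Definition add_ends (x : edge G + {e : edge G | e \in M} * 'I_t) :
    {set vertex G} :=
  match x with inl e => ends e | inr p => ends (val p.1) end.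

Lemma card_add_ends x : #|add_ends x| = 2.
Proof. by case: x => [e|p]; apply: card_ends. Qed.

(* G + tM: the copies of e in M are the edges inr (e, i) with i < t. *)
Definition add_matching : mgraph := MGraph card_add_ends.

End AddMatching.
End Multigraph.

(* The least natural number satisfying P, +oo if there is none. *)
Definition least (P : nat -> Prop) : \bar rat :=
  match pselect (exists n, `[< P n >]) with
  | left exP => ((ex_minn exP)%:R%:E)%R
  | right _ => +oo%E
  end.

Definition scc (G : mgraph) : \bar rat :=
  least (fun k => exists2 CC : seq {set edge G},
                    cycle_cover CC & cover_length CC = k).

Definition l_ (G : mgraph) (M : {set edge G}) : \bar rat :=
  least (fun t => class_I (add_matching M t)).

Definition frumious (G : mgraph) : Prop :=
  forall M : {set edge G}, perfect_matching M -> l_ M = +oo%E.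

(* Main.v *)
(** A cycle cover meets every vertex of a cubic graph an even number of times,
    and at least three times, hence at least four times; so its length is at
    least 4/3 |E|, with equality iff the edges covered twice form a perfect
    matching M and all other edges are covered once.  On the other side, a
    (t+3)-edge-colouring of G + tM is a family of t+3 perfect matchings of G
    covering the edges of M exactly t+1 times and the other edges once.  Taking
    symmetric differences with M exchanges the two kinds of families. *)
Require Import Defs.
From HB Require Import structures.
From mathcomp Require Import all_boot all_order all_algebra.
From mathcomp Require Import boolp constructive_ereal.
From mathcomp Require Import zify lra.

Set Implicit Arguments.
Unset Strict Implicit.
Unset Printing Implicit Defensive.

Import Order.TTheory GRing.Theory Num.Theory.

(** * Symmetric differences and sums over finite types *)

Definition symdiff (T : finType) (A B : {set T}) : {set T} :=
  [set x | (x \in A) (+) (x \in B)].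

(** Termwise bounds with equal totals leave no slack. This turns a global count into equalities at
    each vertex, or for each member of a family. *)
Lemma eq_sum_of_leq (I : finType) (E F : I -> nat) :
  (forall i, E i <= F i) -> \sum_i E i = \sum_i F i -> forall i, E i = F i.
Proof.
move=> leEF eqEF i; apply/eqP.
have leifEF j : xpredT j -> E j <= F j ?= iff (E j == F j) by split.
have [_] := leqif_sum leifEF.
by rewrite eqEF eqxx => /esym/forall_inP; apply.
Qed.

Lemma sum_mem (I : finType) (P : pred I) : \sum_i (P i : nat) = #|[set i | P i]|.
Proof.
by rewrite -sum1dep_card [RHS]big_mkcond; apply: eq_bigr => i _; case: (P i).
Qed.

(** * Double counting of degrees *)

Section DegreeCounting.
Variable G : mgraph.
Implicit Types (A M C : {set edge G}) (v : vertex G) (e : edge G).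

Lemma deg_inE A v : deg_in A v = \sum_(e | v \in ends e) (e \in A).
Proof.
rewrite /deg_in -sum1_card [RHS]big_mkcond [LHS]big_mkcond.
by apply: eq_bigr => e _; rewrite !inE; case: (e \in A); case: (v \in _).
Qed.

Lemma sum_vertex_const k : \sum_(v : vertex G) k = #|vertex G| * k.
Proof. by rewrite sum_nat_const. Qed.

(** Weighted handshake identity: each edge is counted at its two ends. *)
Lemma sum_ends (w : edge G -> nat) :
  \sum_v \sum_(e | v \in ends e) w e = 2 * \sum_e w e.
Proof.
rewrite (exchange_big_dep xpredT) //= big_distrr; apply: eq_bigr => e _.
by rewrite sum_nat_const card_ends.
Qed.

Lemma odd_deg_symdiff A C v :
  odd (deg_in (symdiff A C) v) = odd (deg_in A v) (+) odd (deg_in C v).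
Proof.
rewrite !deg_inE.
elim/big_rec3: _ => //= e x y z _; rewrite !oddD => ->.
by rewrite inE !oddb addbACA.
Qed.

Lemma sum_deg_in (I : finType) (N : I -> {set edge G}) v :
  \sum_i deg_in (N i) v = \sum_(e | v \in ends e) #|[set i | e \in N i]|.
Proof.
under eq_bigr => i _ do rewrite deg_inE.
rewrite exchange_big; apply: eq_bigr => e _.
by rewrite -sum_mem.
Qed.

Lemma sum_card_sets (I : finType) (N : I -> {set edge G}) :
  \sum_i #|N i| = \sum_e #|[set i | e \in N i]|.
Proof.
under eq_bigr => i _ do rewrite -[#|_|]cardsE -sum_mem.
rewrite exchange_big; apply: eq_bigr => e _.
by rewrite -sum_mem.
Qed.

Lemma perfect_matching_unique M v e e' :
  perfect_matching M -> e \in M -> e' \in M -> v \in ends e -> v \in ends e' ->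
  e = e'.
Proof.
move=> /(_ v)/eqP/cards1P[x defx] eM e'M ve ve'.
have: e \in [set x] by rewrite -defx inE eM.
have: e' \in [set x] by rewrite -defx inE e'M.
by rewrite !inE => /eqP-> /eqP->.
Qed.

Lemma card_perfect_matching M : perfect_matching M -> #|vertex G| = 2 * #|M|.
Proof.
move=> pM; rewrite -[#|M|]cardsE -sum_mem -sum_ends -sum1_card.
by apply: eq_bigr => v _; rewrite -deg_inE pM.
Qed.

Hypothesis hcubic : cubic G.

Lemma cubic_sum_ends v : \sum_(e | v \in ends e) 1 = 3.
Proof. by rewrite -(hcubic v) /degree deg_inE; apply: eq_bigr => e _; rewrite inE. Qed.

Lemma card_cubic : 3 * #|vertex G| = 2 * #|edge G|.
Proof.
rewrite -[#|edge G|]sum1_card -sum_ends mulnC -sum_nat_const.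
by apply: eq_bigr => v _; rewrite cubic_sum_ends.
Qed.

End DegreeCounting.

(** * Edge colourings of regular multigraphs *)

Section Colouring.
Variable G : mgraph.

Lemma edge_colorableP k :
  reflect (exists f : edge G -> 'I_k, forall v e e',
             v \in ends e -> v \in ends e' -> f e = f e' -> e = e')
          (edge_colorable G k).
Proof.
apply: (iffP existsP) => -[f fP].
  exists f => v e e' ve ve' eqf; apply/eqP/idPn => ne.
  have nd : ~~ [disjoint ends e & ends e'] by apply/pred0Pn; exists v; rewrite /= ve.
  have /forallP/(_ e')/implyP := forallP fP e.
  by rewrite ne nd eqf eqxx => /(_ isT).
exists (finfun f); apply/forallP=> e; apply/forallP=> e'.
apply/implyP=> /andP[ne /pred0Pn[v /= /andP[ve ve']]].
by rewrite !ffunE; apply: contraNneq ne => /(fP v _ _ ve ve') ->.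
Qed.

Lemma degree_leq_colors k (v : vertex G) : edge_colorable G k -> degree v <= k.
Proof.
move=> /edge_colorableP[f fP]; rewrite -[k]card_ord /degree /deg_in.
rewrite -(card_in_imset (f := f)) ?max_card // => e e'.
by rewrite !inE => ve ve'; apply: fP ve ve'.
Qed.

(** The edges at a vertex need [k] distinct colours, so the chromatic index is at least the maximum
    degree [k]; it equals [k] as soon as [k] colours suffice. *)
Lemma regular_class_I k : 0 < #|vertex G| -> (forall v : vertex G, degree v = k) ->
  class_I G <-> edge_colorable G k.
Proof.
move=> /card_gt0P[v0 _] regG.
have maxG : max_degree G = k.
  apply/eqP; rewrite eqn_leq -{2}(regG v0) leq_bigmax ?andbT //.
  by apply/bigmax_leqP => v _; rewrite regG.
rewrite /class_I maxG /chromatic_index; case: ex_minnP => m colm minm.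
split=> [<- // | colk]; apply/eqP; rewrite eqn_leq minm //=.
by rewrite -(regG v0) degree_leq_colors.
Qed.

End Colouring.

(** * Colourings of G + tM as families of perfect matchings of G *)

Section AddMatching.
Variables (G : mgraph) (M : {set edge G}) (t : nat).
Let H := add_matching M t.

Definition base_edge (x : edge H) : edge G :=
  match x with inl e => e | inr p => val p.1 end.

Lemma ends_base_edge x : ends (base_edge x) = ends x.
Proof. by case: x. Qed.

(** The original edge gets number 0 and its added parallels 1 to [t], so the edges over a given edge
    of [G] are numbered consecutively from 0. *)
Definition copy_index (x : edge H) : nat :=
  match x with inl _ => 0 | inr p => p.2.+1 end.

Lemma base_edge_index_inj x y :
  base_edge x = base_edge y -> copy_index x = copy_index y -> x = y.
Proof.
case: x y => [e|[u i]] [e'|[u' i']] //= => [-> //|].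
by move=> /val_inj-> [/ord_inj->].
Qed.

Lemma card_base_edge e : #|[set x | base_edge x == e]| = 1 + t * (e \in M).
Proof.
rewrite -sum1dep_card big_sumType /= big_pred1_eq; congr (_ + _).
under eq_bigl => p do rewrite -[_ == e]andbT.
rewrite -(pair_big (fun u : {e | e \in M} => val u == e) xpredT (fun _ (_ : 'I_t) => 1)) /=.
under eq_bigr => u _ do rewrite sum_nat_const card_ord muln1.
rewrite sum_nat_const mulnC; congr (_ * _).
have [eM|eNM] := boolP (e \in M).
  by rewrite (eq_card (B := pred1 (Sub e eM))) ?card1 // => u.
by apply: eq_card0 => u; apply: contraNF eNM => /eqP <-; apply: valP.
Qed.

Lemma copy_index_lt x : copy_index x < 1 + t * (base_edge x \in M).
Proof.
by case: x => [e|[[e eM] i]] //=; rewrite eM muln1 add1n ltnS.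
Qed.

Hypothesis hcubic : cubic G.
Hypothesis pM : perfect_matching M.

Lemma degree_add_matching (v : vertex H) : degree v = t + 3.
Proof.
rewrite /degree deg_inE (partition_big base_edge (fun e => v \in ends e)) /=; last first.
  by move=> x; rewrite ends_base_edge.
have -> : t + 3 = \sum_(e : edge G | v \in ends e) (1 + t * (e \in M)).
  by rewrite big_split /= cubic_sum_ends // -big_distrr /= -deg_inE pM muln1 addnC.
apply: eq_bigr => e ve; rewrite -card_base_edge -sum1dep_card.
apply: eq_big => [x|x _]; last by rewrite inE.
case: eqP => [xe|_]; rewrite ?andbF // andbT.
by have := ve; rewrite -xe ends_base_edge.
Qed.

(** The colour classes of a (t+3)-edge-colouring, projected to [G]; the prescribed multiplicity of
    [e] is the number of edges of G + tM over [e]. *)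
Definition matching_family (N : 'I_(t + 3) -> {set edge G}) :=
  (forall i, perfect_matching (N i)) /\
  (forall e, #|[set i | e \in N i]| = 1 + t * (e \in M)).

(** Since G + tM is (t+3)-regular, every colour occurs at every vertex, so colour classes project to
    perfect matchings. Conversely, the edges over [e] are as many as the matchings containing [e],
    and are coloured bijectively by the indices of these. *)
Lemma colorable_matching_family :
  edge_colorable H (t + 3) <-> exists N, matching_family N.
Proof.
split=> [/edge_colorableP[f fP] | [N [pN cardN]]].
  exists (fun i => base_edge @: [set x | f x == i]); split=> [i v | e].
    pose star : {set edge H} := [set x | v \in ends (m := H) x].
    have finj : {in star &, injective f}.
      by move=> x y; rewrite !inE => vx vy; apply: fP vx vy.
    have: i \in f @: star.
      (* The t+3 edges at [v] have distinct colours, hence use all of them. *)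
      suff /eqP-> : f @: star == setT by rewrite inE.
      rewrite eqEcard subsetT cardsT card_ord card_in_imset //.
      rewrite -(degree_add_matching v) /degree /deg_in.
      by apply: subset_leq_card; apply/subsetP => x; rewrite !inE.
    case/imsetP=> x; rewrite inE => vx fx; apply/eqP/cards1P; exists (base_edge x).
    apply/setP=> e; rewrite !inE; apply/andP/eqP=> [[/imsetP[y]] | ->].
      rewrite inE fx => /eqP fy -> ; rewrite ends_base_edge => vy.
      by rewrite (fP v _ _ vy vx fy).
    by rewrite ends_base_edge; split=> //; apply: imset_f; rewrite inE fx.
  (* Edges over [e] share an end, so their colours differ: counting colours amounts to counting
     these edges. *)
  rewrite -card_base_edge -(card_in_imset (f := f)); last first.
    move=> x y; rewrite !inE => /eqP xe /eqP ye.
    have /card_gt0P[v ve] : 0 < #|ends e| by rewrite card_ends.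
    by apply: (fP v); rewrite -ends_base_edge ?xe ?ye.
  apply: eq_card => i; rewrite inE; apply/imsetP/imsetP=> [] [x].
    by rewrite inE => /eqP fx ->; exists x; rewrite ?inE ?fx.
  by rewrite inE => /eqP xe ->; exists x; rewrite ?inE ?xe.
have i0 : 'I_(t + 3) by rewrite addn3; apply: ord0.
pose s e := enum [set i | e \in N i].
have szs e : size (s e) = 1 + t * (e \in M) by rewrite -cardE cardN.
have ltsz x : copy_index x < size (s (base_edge x)).
  by rewrite szs copy_index_lt.
(* The copy numbered j of [e] gets the j-th index of a matching containing [e]; the default [i0] is
   never reached, by [ltsz]. *)
pose f x := nth i0 (s (base_edge x)) (copy_index x).
have fN x : base_edge x \in N (f x).
  by have := mem_nth i0 (ltsz x); rewrite mem_enum inE.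
apply/edge_colorableP; exists f => v x y; rewrite -!ends_base_edge => vx vy fxy.
(* Both base edges lie at [v] in the same perfect matching; afterwards the duplicate-free list of
   indices separates the copies. *)
have xy : base_edge x = base_edge y.
  by apply: (perfect_matching_unique (pN (f x)) (fN x) _ vx vy); rewrite fxy fN.
apply: base_edge_index_inj => //; apply/eqP.
rewrite -(nth_uniq i0 (ltsz x) _ (enum_uniq _)) ?xy ?ltsz //.
by move: fxy; rewrite /f xy => ->.
Qed.

End AddMatching.

(** Symmetric difference with [M] complements membership for the edges of [M] and preserves it for
    the others. *)
Lemma card_symdiff_family (G : mgraph) (M : {set edge G}) (I : finType)
    (N : I -> {set edge G}) e :
  #|[set i | e \in symdiff M (N i)]| =
    if e \in M then #|I| - #|[set i | e \in N i]| else #|[set i | e \in N i]|.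
Proof.
have [eM|eNM] := boolP (e \in M).
  by rewrite cardsCs; congr (_ - _); apply: eq_card => i; rewrite !inE eM negbK.
by apply: eq_card => i; rewrite !inE (negPf eNM).
Qed.

(** * The lower bound on the length of a cycle family, and its equality case *)

Section CycleFamilies.
Variables (G : mgraph) (I : finType) (N : I -> {set edge G}).
Hypothesis hcubic : cubic G.
Hypothesis cycN : forall i, is_cycle (N i).
Hypothesis covN : forall e, 0 < #|[set i | e \in N i]|.

(** The sum is at least 3, as three covered edges meet [v], and it is even, being a sum of degrees
    in even subgraphs. *)
Lemma vertex_cover_geq4 v : 4 <= \sum_(e | v \in ends e) #|[set i | e \in N i]|.
Proof.
have ge3 : 3 <= \sum_(e | v \in ends e) #|[set i | e \in N i]|.
  by rewrite -(cubic_sum_ends hcubic v) leq_sum.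
have: ~~ odd (\sum_(e | v \in ends e) #|[set i | e \in N i]|).
  rewrite -sum_deg_in; elim/big_rec: _ => //= i x _.
  by rewrite oddD (negPf (cycN i v)).
by move: ge3; rewrite leq_eqVlt => /predU1P[<-|].
Qed.

Lemma cycle_family_length : 4 * #|edge G| <= 3 * \sum_i #|N i|.
Proof.
have : \sum_(v : vertex G) 4 <= \sum_v \sum_(e | v \in ends e) #|[set i | e \in N i]|.
  by apply: leq_sum => v _; apply: vertex_cover_geq4.
rewrite sum_ends -sum_card_sets sum_vertex_const; have := card_cubic hcubic; lia.
Qed.

(** Equality forces the sum 4 at every vertex. The excess [r] of the multiplicities over 1 then sums
    to 1 there, so [r] is the indicator function of a perfect matching. *)
Lemma tight_cycle_family : 3 * \sum_i #|N i| = 4 * #|edge G| ->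
  exists2 M : {set edge G}, perfect_matching M &
    forall e, #|[set i | e \in N i]| = 1 + (e \in M).
Proof.
move=> tight; pose r e := #|[set i | e \in N i]|.-1.
have rE e : #|[set i | e \in N i]| = 1 + r e by rewrite add1n prednK.
have sum_r v : \sum_(e | v \in ends e) r e = 1.
  have: \sum_(e | v \in ends e) #|[set i | e \in N i]| = 4.
    apply/esym/(eq_sum_of_leq vertex_cover_geq4).
    rewrite sum_ends -sum_card_sets sum_vertex_const; have := card_cubic hcubic; lia.
  under eq_bigr => e _ do rewrite rE.
  by rewrite big_split /= (cubic_sum_ends hcubic) => -[].
pose M := [set e | r e != 0].
have rM e : r e = (e \in M).
  have /card_gt0P[v ve] : 0 < #|ends e| by rewrite card_ends.
  have := sum_r v; rewrite (bigD1 e) //= inE; by case: (r e) => [|[]].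
exists M => [v | e]; last by rewrite rE rM.
by rewrite deg_inE -(sum_r v); apply: eq_bigr => e _; rewrite rM.
Qed.

End CycleFamilies.

(** * Exchanging matching families and cycle families *)

Section Exchange.
Variables (G : mgraph) (t : nat).
Implicit Types (M : {set edge G}) (N : 'I_(t + 3) -> {set edge G}).
Hypothesis hcubic : cubic G.

(** Two odd degrees add up to an even one, and an edge of [M] keeps (t+3) - (t+1) = 2 of the
    sets. *)
Lemma cycles_of_matchings M N : perfect_matching M -> matching_family M N ->
  (forall i, is_cycle (symdiff M (N i))) /\
  (forall e, #|[set i | e \in symdiff M (N i)]| = 1 + (e \in M)).
Proof.
move=> pM [pN cardN]; split=> [i v | e].
  by rewrite odd_deg_symdiff pM pN.
by rewrite card_symdiff_family card_ord cardN; case: (e \in M); lia.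
Qed.

(* Each of the t + 3 symmetric differences has odd degree at v, and these
   degrees add up to t + 3, so they are all 1. *)
Lemma matchings_of_cycles M N : perfect_matching M ->
  (forall i, is_cycle (N i)) ->
  (forall e, #|[set i | e \in N i]| = 1 + (e \in M)) ->
  matching_family M (fun i => symdiff M (N i)).
Proof.
move=> pM cycN cardN.
have cardS e : #|[set i | e \in symdiff M (N i)]| = 1 + t * (e \in M).
  by rewrite card_symdiff_family card_ord cardN; case: (e \in M); lia.
split=> // i v; move: i; apply: fsym; apply: eq_sum_of_leq => [i|].
  rewrite lt0n; apply/eqP => deg0.
  by have := odd_deg_symdiff M (N i) v; rewrite deg0 pM (negPf (cycN i v)).
rewrite sum_deg_in sum_nat_const card_ord muln1.
under eq_bigr => e _ do rewrite cardS.
by rewrite big_split /= cubic_sum_ends // -big_distrr /= -deg_inE pM muln1 addnC.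
Qed.

End Exchange.

(** * Cycle covers of length 4/3 |E(G)| *)

Section TightCovers.
Variable G : mgraph.
Hypothesis hcubic : cubic G.

(* Three empty cycles are appended, so that the number of cycles has the form
   t + 3. *)
Lemma cycle_cover_family (CC : seq {set edge G}) : cycle_cover CC ->
  let N (i : 'I_(size CC + 3)) := nth set0 CC i in
  [/\ forall i, is_cycle (N i), forall e, 0 < #|[set i | e \in N i]|
    & cover_length CC = \sum_i #|N i|].
Proof.
move=> [cycC covC] N; split=> [i | e |].
- rewrite /N; have [ltis|leis] := ltnP i (size CC); first by apply/cycC/mem_nth.
  by rewrite nth_default // => v; rewrite deg_inE big1 // => e _; rewrite inE.
- have [C CinCC eC] := covC e; apply/card_gt0P.
  have ltC : index C CC < size CC + 3 by rewrite ltn_addr ?index_mem.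
  by exists (Ordinal ltC); rewrite inE /N /= nth_index.
- rewrite /cover_length (big_nth set0) big_mkord big_split_ord /= [X in _ + X]big1 ?addn0 //.
  by move=> i _; rewrite /N nth_default ?cards0 //= leq_addr.
Qed.

Lemma cover_length_geq (CC : seq {set edge G}) : cycle_cover CC ->
  4 * #|edge G| <= 3 * cover_length CC.
Proof. by move=> /cycle_cover_family[cycN covN ->]; apply: cycle_family_length. Qed.

Lemma tight_cover_iff :
  (exists2 CC : seq {set edge G}, cycle_cover CC &
     3 * cover_length CC = 4 * #|edge G|) <->
  (exists2 M : {set edge G}, perfect_matching M &
     exists t, edge_colorable (add_matching M t) (t + 3)).
Proof.
split=> [[CC /cycle_cover_family[cycN covN ->]] tight | [M pM [t]]].
  have [M pM cardN] := tight_cycle_family hcubic cycN covN tight.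
  (* With t the number of cycles, the padded family has exactly t+3 members. *)
  exists M => //; exists (size CC).
  by apply/colorable_matching_family => //; eexists; apply: matchings_of_cycles cardN.
move=> /colorable_matching_family[] // N /(cycles_of_matchings pM)[cycN cardN].
exists [seq symdiff M (N i) | i <- enum 'I_(t + 3)]; first split=> [C | e].
- by case/mapP=> i _ ->.
- have /card_gt0P[i] : 0 < #|[set i | e \in symdiff M (N i)]| by rewrite cardN.
  rewrite inE => ei; exists (symdiff M (N i)) => //.
  by apply/mapP; exists i; rewrite ?mem_enum.
have lenE : \sum_e (1 + (e \in M)) = #|edge G| + #|M|.
  by rewrite big_split /= sum1_card sum_mem cardsE.
rewrite /cover_length big_map big_enum sum_card_sets.
under eq_bigr => e _ do rewrite cardN.
(* The length is |E| + |M|, where |M| = |V|/2 = |E|/3. *)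
rewrite lenE; have := card_cubic hcubic; have := card_perfect_matching pM; lia.
Qed.

End TightCovers.

(** * Minima with values in the extended rationals *)

Section Least.
Variable P : nat -> Prop.

Lemma least_pinfty : least P = +oo%E <-> forall n, ~ P n.
Proof.
rewrite /least; case: pselect => [exP|nexP]; split=> //.
  by move=> noP; have [n /asboolP/noP] := exP.
by move=> _ n Pn; apply: nexP; exists n; apply/asboolP.
Qed.

Lemma least_eq n : P n -> (forall m, P m -> n <= m) -> least P = (n%:R%:E)%R.
Proof.
move=> Pn minn; rewrite /least; case: pselect => [exP|[]]; last first.
  by exists n; apply/asboolP.
case: ex_minnP => m /asboolP Pm /(_ n)/(_ (asboolT Pn)) lemn.
by congr ((_ %:R)%:E)%R; apply/eqP; rewrite eqn_leq lemn minn.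
Qed.

(** A finite minimum is attained, so bounding it strictly bounds every value; if it is infinite,
    both sides hold. *)
Lemma lt_least (r : rat) :
  (r%:E < least P)%E <-> forall n, P n -> (r < n%:R)%R.
Proof.
rewrite /least; case: pselect => [exP|nexP].
  case: ex_minnP => m /asboolP Pm minm; rewrite lte_fin; split=> [ltrm n Pn|]; last exact.
  by apply: lt_le_trans ltrm _; rewrite ler_nat minm //; apply/asboolP.
by rewrite ltry; split=> // _ n Pn; case: nexP; exists n; apply/asboolP.
Qed.

End Least.

(** * Comparing scc(G) with 4/3 |E(G)| *)

Local Open Scope ring_scope.

Theorem theorem5p4 (G : mgraph) (hbridgeless : bridgeless G) (hcubic : cubic G) :
  (((4 / 3 * #|edge G|%:R)%:E < scc G)%E <-> frumious G) /\
  (~ frumious G -> scc G = (4 / 3 * #|edge G|%:R)%:E).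
Proof.
have [V_gt1 _] := hbridgeless.
have fin_l (M : {set edge G}) : perfect_matching M ->
    l_ M = +oo%E <-> forall t, ~ edge_colorable (add_matching M t) (t + 3).
  move=> pM; rewrite /l_ least_pinfty.
  have colE t : class_I (add_matching M t) <-> edge_colorable (add_matching M t) (t + 3).
    apply: regular_class_I; first exact: ltnW.
    exact: degree_add_matching.
  by split=> nocol t /(colE t); apply: nocol.
(* Being frumious thus amounts to the absence of a cover attaining the lower bound. *)
have frumiousE : frumious G <-> ~ exists2 CC : seq {set edge G}, cycle_cover CC &
    (3 * cover_length CC = 4 * #|edge G|)%N.
  rewrite (tight_cover_iff hcubic); split=> [frG [M pM [t]]|nocol M pM].
    by have /(fin_l M pM) := frG M pM; apply.
  by apply/(fin_l M pM) => t col; apply: nocol; exists M => //; exists t.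
have lengthE n : (4 / 3 * #|edge G|%:R < n%:R :> rat) = (4 * #|edge G| < 3 * n)%N.
  rewrite -(ltr_nat rat) !natrM; apply/idP/idP; lra.
split.
  rewrite frumiousE /scc lt_least; split=> [lt_len [CC covCC tight] | notight n [CC covCC <-]].
    have := lt_len _ (ex_intro2 _ _ CC covCC erefl).
    by rewrite lengthE tight ltnn.
  rewrite lengthE ltn_neqAle cover_length_geq // andbT; apply/eqP => tight.
  by apply: notight; exists CC.
(* Classically, a graph that is not frumious has a tight cover, which is shortest by the lower
   bound. *)
rewrite frumiousE => /contrapT[CC covCC tight].
rewrite /scc (@least_eq _ (cover_length CC)); first 1 last.
- by exists CC.
- move=> m [CC' covCC' <-]; rewrite -(leq_pmul2l (isT : 0 < 3)%N) tight.
  exact: cover_length_geq.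
congr (_ %:E); have := congr1 (fun n => n%:R : rat) tight.
by rewrite !natrM; lra.
Qed.
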